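(* Let $n\ge1$ and fix $b\in\Delta_n\setminus\{e_n\}$. For $c\in\Delta_n$, consider only the coordinates $r\in\operatorname{supp}(b)=\{r:b_r\ne7\}$, and let $$A=\#\{r:c_r=b_r\},\qquad B=\#\{r:c_r=\gamma(b_r)\},\qquad C=\#\{r:c_r=\gamma^2(b_r)\},$$ each count being over $r\in\operatorname{supp}(b)$ only (so coordinates with $c_r=7$, and all coordinates with $b_r=7$, are omitted). Then $$c\in C_{+}(b)\iff A\equiv B\equiv C\pmod 2,$$ and $$c\in C_{-}(b)\iff B\equiv C\not\equiv A\pmod 2.$$ Consequently, $\gamma(C_{+}(b))=C_{+}(b)$, and there is a disjoint decomposition $$\Delta_n=C_{+}(b)\sqcup C_{-}(b)\sqcup\gamma(C_{-}(b))\sqcup\gamma^2(C_{-}(b)).$$ Equivalently, every global $\gamma$-orbit in $\Delta_n$ is either contained in $C_{+}(b)$ or meets $C_{-}(b)$ in exactly one element.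
   Context: $\Delta_n=\{1,2,4,7\}^n$ is the set of words of length $n$, and $e_n=77\cdots7$. Digits are identified with quaternionic symbols: $1=i$, $2=j$, $4=k$, $7=e$, where $e$ is the identity, $i^2=j^2=k^2=-e$, $ij=k=-ji$, $jk=i=-kj$, $ki=j=-ik$. Words are multiplied coordinate by coordinate, with the local quaternionic signs collected into one global sign, so that products lie in $\Delta_n\sqcup(-\Delta_n)$. $\gamma$ is the cycle $1\mapsto2\mapsto4\mapsto1$, $7\mapsto7$ (i.e. $i\mapsto j\mapsto k\mapsto i$); on words it is applied in every coordinate (the global cyclic action). For $b\in\Delta_n$, $C_{+}(b)=\{c\in\Delta_n:cb=bc\text{ and }cb\in\Delta_n\}$ and $C_{-}(b)=\{c\in\Delta_n:cb=bc\text{ and }cb\in-\Delta_n\}$. *)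

(* Defs.v *)
From HB Require Import structures.
From mathcomp Require Import all_boot.

Set Implicit Arguments.
Unset Strict Implicit.
Unset Printing Implicit Defensive.

(* The digits 1, 2, 4, 7 stand for the quaternion symbols i, j, k, e. *)
Inductive digit : Type := D1 | D2 | D4 | D7.

Definition nat_of_digit (x : digit) : nat :=
  match x with D1 => 1 | D2 => 2 | D4 => 4 | D7 => 7 end.

Definition digit_of_nat (m : nat) : option digit :=
  match m with
  | 1 => Some D1 | 2 => Some D2 | 4 => Some D4 | 7 => Some D7 | _ => None
  end.

Lemma nat_of_digitK : pcancel nat_of_digit digit_of_nat.
Proof. by case. Qed.

HB.instance Definition _ := Countable.copy digit (pcan_type nat_of_digitK).

Lemma digit_enumP : Finite.axiom [:: D1; D2; D4; D7].
Proof. by case. Qed.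

HB.instance Definition _ := isFinite.Build digit digit_enumP.

(* Product of two quaternion symbols; the pair (s, x) denotes -x if s = true
   and x if s = false. *)
Definition digit_mul (x y : digit) : bool * digit :=
  match x, y with
  | D7, _ => (false, y)
  | _, D7 => (false, x)
  | D1, D1 | D2, D2 | D4, D4 => (true, D7)
  | D1, D2 => (false, D4) | D2, D1 => (true, D4)
  | D2, D4 => (false, D1) | D4, D2 => (true, D1)
  | D4, D1 => (false, D2) | D1, D4 => (true, D2)
  end.

Definition gamma (x : digit) : digit :=
  match x with D1 => D2 | D2 => D4 | D4 => D1 | D7 => D7 end.

Notation word n := {ffun 'I_n -> digit}.

Notation signed_word n := (bool * word n)%type.

Definition pos_word n (w : word n) : signed_word n := (false, w).
Definition neg_word n (w : word n) : signed_word n := (true, w).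

Definition Delta n : {set signed_word n} := [set pos_word w | w : word n].
Definition negDelta n : {set signed_word n} := [set neg_word w | w : word n].

Definition word_mul n (c b : word n) : signed_word n :=
  (\big[addb/false]_(r < n) (digit_mul (c r) (b r)).1,
   [ffun r => (digit_mul (c r) (b r)).2]).

Definition word_e n : word n := [ffun=> D7].

Definition word_gamma n (c : word n) : word n := [ffun r => gamma (c r)].

Definition supp n (b : word n) : {set 'I_n} := [set r | b r != D7].

Definition Cplus n (b : word n) : {set word n} :=
  [set c | (word_mul c b == word_mul b c) && (word_mul c b \in Delta n)].

Definition Cminus n (b : word n) : {set word n} :=
  [set c | (word_mul c b == word_mul b c) && (word_mul c b \in negDelta n)].

(* Main.v *)
(* A coordinate in supp(b) contributes a minus sign to cb exactly when
   c_r = b_r or c_r = gamma(b_r), and to bc exactly when c_r = b_r or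
   c_r = gamma^2(b_r); the unsigned products always agree.  Hence the signs of
   cb and bc are the parities of A + B and A + C, which gives the criterion.
   Applying gamma to c permutes (A, B, C) cyclically: if the parities are all
   equal they stay so, and otherwise exactly one of the three cyclic shifts
   puts the odd one out in the position of A. *)
Require Import Defs.
From mathcomp Require Import all_boot.

Set Implicit Arguments.
Unset Strict Implicit.
Unset Printing Implicit Defensive.

Lemma gamma3 : cancel gamma (gamma \o gamma).
Proof. by case. Qed.

Lemma word_gamma3 n (c : word n) : word_gamma (word_gamma (word_gamma c)) = c.
Proof. by apply/ffunP => r; rewrite !ffunE; apply: gamma3. Qed.

(** Since $\gamma^3=1$, the inverse of $\gamma$ is $\gamma^2$, so membership in an image becomes
    membership of a shifted word. *)
Lemma word_gamma_imset n (X : {set word n}) (c : word n) :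
  (c \in @word_gamma n @: X) = (word_gamma (word_gamma c) \in X).
Proof.
by rewrite (@can2_imset_pre _ _ _ (iter 2 (@word_gamma n))) ?inE;
  try exact: word_gamma3.
Qed.

Lemma word_gamma2_imset n (X : {set word n}) (c : word n) :
  (c \in iter 2 (@word_gamma n) @: X) = (word_gamma c \in X).
Proof.
by rewrite (@can2_imset_pre _ _ _ (@word_gamma n)) ?inE;
  try exact: word_gamma3.
Qed.

(** The cases $k=0,1,2$ are the sets counted by $A$, $B$, $C$; a single index lets $\gamma$ act by
    shifting $k$. *)
Definition agree n k (b c : word n) : {set 'I_n} :=
  [set r in supp b | c r == iter k gamma (b r)].

(** Puts a parity in the same form as the sign in [word_mul], an exclusive or over all coordinates,
    so that the two can be compared digit by digit. *)
Lemma odd_agree n k (b c : word n) :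
  odd #|agree k b c| =
  \big[addb/false]_(r < n) ((b r != D7) && (c r == iter k gamma (b r))).
Proof.
rewrite -sum1_card big_mkcond (big_morph odd oddD (erefl : odd 0 = false)).
by apply: eq_bigr => r _; rewrite !inE; case: ifP.
Qed.

Lemma word_mul_sign n (b c : word n) :
  (word_mul c b).1 = odd #|agree 0 b c| (+) odd #|agree 1 b c|.
Proof.
rewrite !odd_agree -big_split; apply: eq_bigr => r _ /=.
by case: (b r); case: (c r).
Qed.

Lemma word_mul_signC n (b c : word n) :
  (word_mul b c).1 = odd #|agree 0 b c| (+) odd #|agree 2 b c|.
Proof.
rewrite !odd_agree -big_split; apply: eq_bigr => r _ /=.
by case: (b r); case: (c r).
Qed.

Lemma word_mul_symC n (b c : word n) : (word_mul b c).2 = (word_mul c b).2.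
Proof. by apply/ffunP => r; rewrite !ffunE; case: (b r); case: (c r). Qed.

(** The unsigned products agree, so commuting means equal signs, and the parity of $A$ cancels from
    both. *)
Lemma word_mulC n (b c : word n) :
  (word_mul c b == word_mul b c) =
  (odd #|agree 1 b c| == odd #|agree 2 b c|).
Proof.
rewrite -pair_eqE /pair_eq word_mul_symC eqxx andbT.
by rewrite word_mul_sign word_mul_signC (inj_eq (@addbI _)).
Qed.

Lemma mem_Delta n (w : signed_word n) : (w \in Delta n) = ~~ w.1.
Proof.
case: w => -[] w; last by rewrite [LHS]imset_f.
by apply/negbTE/imsetP => -[].
Qed.

Lemma mem_negDelta n (w : signed_word n) : (w \in negDelta n) = w.1.
Proof.
case: w => -[] w; first by rewrite [LHS]imset_f.
by apply/negbTE/imsetP => -[].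
Qed.

Lemma mem_Cplus n (b c : word n) :
  (c \in Cplus b) = (odd #|agree 0 b c| == odd #|agree 1 b c|) &&
                    (odd #|agree 1 b c| == odd #|agree 2 b c|).
Proof.
by rewrite inE word_mulC mem_Delta word_mul_sign andbC; do 3!case: (odd _).
Qed.

Lemma mem_Cminus n (b c : word n) :
  (c \in Cminus b) = (odd #|agree 1 b c| == odd #|agree 2 b c|) &&
                     (odd #|agree 2 b c| != odd #|agree 0 b c|).
Proof.
by rewrite inE word_mulC mem_negDelta word_mul_sign; do 3!case: (odd _).
Qed.

(** As $\gamma$ is injective of order 3, $\gamma(c_r)=\gamma^k(b_r)$ iff $c_r=\gamma^{k-1}(b_r)$,
    with exponents modulo 3. *)
Lemma agree_word_gamma n (b c : word n) :
  [/\ agree 0 b (word_gamma c) = agree 2 b c,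
      agree 1 b (word_gamma c) = agree 0 b c
    & agree 2 b (word_gamma c) = agree 1 b c].
Proof.
by split; apply/setP => r; rewrite !inE ffunE /=; case: (b r); case: (c r).
Qed.

Lemma mem_Cplus_gamma n (b c : word n) :
  (word_gamma c \in Cplus b) = (c \in Cplus b).
Proof.
rewrite !mem_Cplus; case: (agree_word_gamma b c) => -> -> ->.
by do 3!case: (odd _).
Qed.

Lemma mem_Cminus_gamma n (b c : word n) :
  (word_gamma c \in Cminus b) =
  (odd #|agree 0 b c| == odd #|agree 1 b c|) &&
  (odd #|agree 1 b c| != odd #|agree 2 b c|).
Proof. by rewrite mem_Cminus; case: (agree_word_gamma b c) => -> -> ->. Qed.

Lemma mem_Cminus_gamma2 n (b c : word n) :
  (word_gamma (word_gamma c) \in Cminus b) =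
  (odd #|agree 2 b c| == odd #|agree 0 b c|) &&
  (odd #|agree 0 b c| != odd #|agree 1 b c|).
Proof.
by rewrite mem_Cminus_gamma; case: (agree_word_gamma b c) => -> -> ->.
Qed.

(** Turns membership in every class into a condition on three parities. The shifted forms precede
    [mem_Cminus], which would also match them. *)
Definition mem_classes :=
  (mem_Cplus, mem_Cminus_gamma2, mem_Cminus_gamma, mem_Cminus).

(** Only membership is compared, because the list has repetitions when $c=e_n$ is a fixed point. *)
Lemma orbit_word_gamma n (c : word n) :
  orbit (@word_gamma n) c =i [:: c; word_gamma c; word_gamma (word_gamma c)].
Proof.
move=> d; rewrite -fconnect_orbit; apply/idP/idP; last first.
  rewrite !inE => /or3P[] /eqP ->; first exact: connect0.
    exact: (fconnect_iter _ 1).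
  exact: (fconnect_iter _ 2).
move/iter_findex <-; elim: (findex _ _ _) => [|k]; first exact: mem_head.
by rewrite iterS !inE => /or3P[] /eqP ->; rewrite ?word_gamma3 eqxx ?orbT.
Qed.

Lemma eq_mod2P p q : reflect (p = q %[mod 2]) (odd p == odd q).
Proof.
by rewrite !modn2; apply: (iffP eqP) => [->|]; last do 2!case: (odd _).
Qed.

Theorem theorem6p9 (n : nat) (hn : 1 <= n) (b : word n) (hb : b <> word_e n) :
  (forall c : word n,
     let A := #|[set r in supp b | c r == b r]| in
     let B := #|[set r in supp b | c r == gamma (b r)]| in
     let C := #|[set r in supp b | c r == gamma (gamma (b r))]| in
     (c \in Cplus b <-> (A = B %[mod 2] /\ B = C %[mod 2])) /\
     (c \in Cminus b <-> (B = C %[mod 2] /\ C <> A %[mod 2]))) /\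
  @word_gamma n @: Cplus b = Cplus b /\
  ([set: word n] =
     Cplus b :|: Cminus b :|: (@word_gamma n @: Cminus b)
       :|: (iter 2 (@word_gamma n) @: Cminus b) /\
   pairwise (fun X Y : {set word n} => [disjoint X & Y])
     [:: Cplus b; Cminus b; @word_gamma n @: Cminus b;
         iter 2 (@word_gamma n) @: Cminus b]) /\
  (forall c : word n,
     {subset orbit (@word_gamma n) c <= Cplus b} \/
     #|[set d in orbit (@word_gamma n) c] :&: Cminus b| = 1).
Proof.
split=> [c A B C|].
  rewrite mem_Cplus mem_Cminus.
  rewrite -/(agree 0 b c) -/(agree 1 b c) -/(agree 2 b c) -/A -/B -/C.
  split; split=> [/andP[/eq_mod2P ? /eq_mod2P] //|[/eq_mod2P-> /eq_mod2P->] //].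
split; first by apply/setP => c; rewrite word_gamma_imset !mem_Cplus_gamma.
split; first split.
- apply/setP => c.
  rewrite !in_setU in_setT word_gamma_imset word_gamma2_imset !mem_classes.
  by do 3!case: (odd _).
(* Each of the six pairwise intersections is refuted on the eight possible parity triples. *)
- by rewrite /= -!setI_eq0 !andbT; do !(apply/andP; split); apply/eqP/setP => c;
    rewrite in_setI in_set0 ?word_gamma_imset ?word_gamma2_imset !mem_classes;
    do 3!case: (odd _).
move=> c; have [cP|cNP] := boolP (c \in Cplus b).
  left=> d; rewrite orbit_word_gamma !in_cons orbF.
  by case/or3P => /eqP ->; rewrite ?mem_Cplus_gamma.
right; apply/eqP/cards1P.
(* When the parities are not all equal, the position of the odd one out selects exactly one of the
   three shifts; that shift is the witness for the singleton. *)
have : [|| [&& c \in Cminus b, word_gamma c \notin Cminus b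
              & word_gamma (word_gamma c) \notin Cminus b],
           [&& c \notin Cminus b, word_gamma c \in Cminus b
              & word_gamma (word_gamma c) \notin Cminus b]
         | [&& c \notin Cminus b, word_gamma c \notin Cminus b
              & word_gamma (word_gamma c) \in Cminus b]].
  by move: cNP; rewrite !mem_classes; do 3!case: (odd _).
by case/or3P => /and3P[m0 m1 m2];
  [exists c | exists (word_gamma c) | exists (word_gamma (word_gamma c))];
  apply/setP => x; rewrite in_setI in_set1 in_set orbit_word_gamma;
  rewrite !in_cons orbF;
  apply/andP/eqP => [[/or3P[] /eqP -> //]|->];
  rewrite ?eqxx ?orbT // ?(negbTE m0) ?(negbTE m1) ?(negbTE m2).
Qed.
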